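(* For every positive integer $t$ and every graph $F$ with minimum degree $t$, we have $f_{F,K_4}(n)=\Omega(n^{1/2-6/\sqrt{t}})$ as $n\to\infty$.
   Context: All graphs are finite and simple. A graph is $F$-free if it does not contain $F$ as a (not necessarily induced) subgraph. For graphs $F,H$ and a positive integer $n$, $f_{F,H}(n)$ denotes the largest $m$ such that every $H$-free graph on $n$ vertices contains an $F$-free induced subgraph on $m$ vertices. $K_4$ is the complete graph on $4$ vertices. The constant implied by $\Omega(\cdot)$ may depend on $F$ but not on $n$. *)

(* Defs.v *)
From HB Require Import structures.
From mathcomp Require Import all_boot all_order all_algebra.
From mathcomp Require Import all_classical all_reals all_analysis.

Set Implicit Arguments.
Unset Strict Implicit.
Unset Printing Implicit Defensive.

Record sgraph := SGraph {
  vertex :> finType;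
  adj : rel vertex;
  adj_sym : symmetric adj;
  adj_irrefl : irreflexive adj
}.

Definition degree (G : sgraph) (v : G) : nat := #|[pred w | adj v w]|.

(* Degrees are less than #|G|, so the default value of the minimum is only
   reached when G has no vertex, in which case the result is 0. *)
Definition min_degree (G : sgraph) : nat := \big[minn/#|G|]_(v : G) degree v.

Section Induced.
Variables (G : sgraph) (S : {set G}).

Definition induced_adj : rel {x : G | x \in S} :=
  fun x y => adj (val x) (val y).

Lemma induced_adj_sym : symmetric induced_adj.
Proof. by move=> x y; rewrite /induced_adj adj_sym. Qed.

Lemma induced_adj_irrefl : irreflexive induced_adj.
Proof. by move=> x; rewrite /induced_adj adj_irrefl. Qed.

Definition induced : sgraph := SGraph induced_adj_sym induced_adj_irrefl.

End Induced.

Section Complete.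
Variable k : nat.

Definition complete_adj : rel 'I_k := fun x y => x != y.

Lemma complete_adj_sym : symmetric complete_adj.
Proof. by move=> x y; rewrite /complete_adj eq_sym. Qed.

Lemma complete_adj_irrefl : irreflexive complete_adj.
Proof. by move=> x; rewrite /complete_adj eqxx. Qed.

Definition complete_graph : sgraph := SGraph complete_adj_sym complete_adj_irrefl.

End Complete.

Definition contains (G F : sgraph) : Prop :=
  exists h : F -> G, injective h /\ forall x y : F, adj x y -> adj (h x) (h y).

Definition subgraph_free (F G : sgraph) : Prop := ~ contains G F.

(* An induced subgraph of a graph on n vertices has at most n vertices, so the
   maximum may be taken over m <= n (as soon as some H-free graph on n vertices
   exists, e.g. the edgeless one when H has an edge). *)
Definition max_free (F H : sgraph) (n : nat) : nat :=
  \max_(m < n.+1 | `[< forall G : sgraph, #|G| = n -> subgraph_free H G ->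
      exists S : {set G}, #|S| = m /\ subgraph_free F (induced S) >]) m.

(* Main.v *)
(* Write [eta = 6 / sqrt t], [n = #|G|], and let [a] be the independence number of
   [G]; we may assume [a < n^(1/2 - eta)]. As [G] is K_4-free, the common
   neighbourhood of two adjacent vertices is independent, so edges have codegree
   at most [a]. A random vertex set picked as the common neighbourhood of [q]
   vertices of a set [U] spans few edges, hence is small; this bounds the [q]-th
   moment of the degrees into [U] (dependent random choice). Multiplying such
   bounds while [U] shrinks, with [q] doubling each time the exponent of
   [|U| / a] is halved, there are at most [(2a)^m n^(2j)] sets of [m] vertices
   with more than about [a n^(2/2^j)] common neighbours.

   Keep every vertex with probability [p = c n^(-1/2 - eta)]. For [m = j k], where
   [k] is about [sqrt t], few of these sets survive. A copy of [F] containing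
   none of them can be built vertex by vertex, with at most
   [a n^(2/2^(d/k))] choices (rounding [d/k] down) for a vertex having [d] earlier
   neighbours. In a random order [d] is uniform on [0..deg], so the average
   exponent is at most [4k/(t+1) <= 2 eta] and few of these copies survive
   either. Deleting one vertex from each surviving object finishes the proof. *)
Require Import Defs.
From HB Require Import structures.
From mathcomp Require Import all_boot all_order all_algebra.
From mathcomp Require Import all_classical all_reals all_analysis.
From mathcomp Require Import fintype finset zify lra.
Import Order.TTheory GRing.Theory Num.Theory.
Import numFieldNormedType.Exports.
Set Implicit Arguments.
Unset Strict Implicit.
Unset Printing Implicit Defensive.

(** * Moments of the degrees into a vertex set *)

Definition nbhd (G : sgraph) (z : G) : {set G} := [set y | adj z y].

Definition common_nbhd (G : sgraph) (A : {set G}) : {set G} :=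
  \bigcap_(z in A) nbhd z.

Definition independent (G : sgraph) (I : {set G}) : Prop :=
  {in I &, forall x y, ~~ adj x y}.

Lemma card_nbhdI_sum (G : sgraph) (U : {set G}) (z : G) :
  #|U :&: nbhd z| = \sum_(y in U) adj z y.
Proof.
rewrite -sum1_card [RHS]big_mkcond /= big_mkcond /=.
by apply: eq_bigr => y _; rewrite !inE; case: (y \in U); case: (adj z y).
Qed.

(* Induction on [q] picks the random vertices of [U] one at a time, each one [y]
   replacing [Z] by [Z :&: nbhd y]; for [q = 0] the claim is
   [|Z| <= a + e(Z)]. *)
Lemma moment_bound (G : sgraph) (a q : nat) (U Z : {set G}) :
  (forall I : {set G}, independent I -> #|I| <= a) ->
  \sum_(z in Z) #|U :&: nbhd z| ^ q <=
  a * #|U| ^ q +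
  \sum_(z in Z) \sum_(w in Z | adj z w) #|U :&: nbhd z :&: nbhd w| ^ q.
Proof.
move=> indep_le; elim: q Z => [|q IHq] Z.
  rewrite expn0 muln1 sum1_card.
  (* The isolated vertices of [Z] form an independent set, and every other vertex of [Z] starts at
     least one of the ordered edges counted on the right. *)
  pose I := [set z in Z | [forall w in Z, ~~ adj z w]].
  have /indep_le Ile : independent I.
    by move=> x y; rewrite !inE => /andP[_ /forall_inP H] /andP[/H].
  rewrite -(cardsID I Z) leq_add //.
    by apply: leq_trans Ile; rewrite subset_leq_card // subsetIr.
  rewrite -sum1_card; apply: (@leq_trans (\sum_(z in Z :\: I) \sum_(w in Z | adj z w) 1)).
    apply: leq_sum => z; rewrite !inE => /andP[/[swap] zZ].
    rewrite zZ /= negb_forall => /existsP[w].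
    rewrite negb_imply negbK => /andP[wZ zw].
    by rewrite (bigD1 w) ?wZ.
  rewrite big_mkcond /= [X in _ <= X]big_mkcond /=; apply: leq_sum => z _.
  by rewrite !inE; case: (z \in Z) => //=; case: ifP.
have -> : \sum_(z in Z) #|U :&: nbhd z| ^ q.+1 =
    \sum_(y in U) \sum_(z in Z :&: nbhd y) #|U :&: nbhd z| ^ q.
  transitivity (\sum_(z in Z) \sum_(y in U) adj z y * #|U :&: nbhd z| ^ q).
    apply: eq_bigr => z _.
    by rewrite expnS {1}card_nbhdI_sum big_distrl.
  rewrite exchange_big /=; apply: eq_bigr => y _.
  rewrite big_mkcond [RHS]big_mkcond /=; apply: eq_bigr => z _.
  by rewrite !inE (adj_sym y z); case: (z \in Z); case: adj => //=; rewrite mul1n.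
have -> : \sum_(z in Z) \sum_(w in Z | adj z w) #|U :&: nbhd z :&: nbhd w| ^ q.+1
   = \sum_(y in U) \sum_(z in Z :&: nbhd y)
       \sum_(w in Z :&: nbhd y | adj z w) #|U :&: nbhd z :&: nbhd w| ^ q.
  transitivity (\sum_(z in Z) \sum_(w in Z | adj z w) \sum_(y in U)
      (adj y z && adj y w) * #|U :&: nbhd z :&: nbhd w| ^ q).
    apply: eq_bigr => z _; apply: eq_bigr => w _.
    rewrite expnS -big_distrl /=; congr (_ * _).
    rewrite card_nbhdI_sum big_mkcond [RHS]big_mkcond /=; apply: eq_bigr => y _.
    rewrite !inE (adj_sym y z) (adj_sym y w).
    by case: (y \in U) => //=; case: (adj z y).
  under eq_bigr => z _ do rewrite exchange_big /=.
  rewrite exchange_big /=; apply: eq_bigr => y _.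
  rewrite big_mkcond [RHS]big_mkcond /=; apply: eq_bigr => z _.
  rewrite !inE; case: (z \in Z) => //=; case yz : (adj y z) => /=; last first.
    by rewrite big1.
  rewrite big_mkcond [RHS]big_mkcond /=; apply: eq_bigr => w _.
  rewrite !inE; case: (w \in Z) => //=; case: (adj y w) => //=.
    by rewrite mul1n.
  by rewrite mul0n if_same.
have -> : a * #|U| ^ q.+1 = \sum_(y in U) a * #|U| ^ q.
  by rewrite sum_nat_const expnS mulnCA.
by rewrite -big_split /=; apply: leq_sum => y _; apply: IHq.
Qed.

(** This is [moment_bound] with [Z] the whole vertex set. By the codegree bound the edge term is at
    most [n^2 a^q], which the last hypothesis makes no larger than the main term. *)
Lemma moment_le (G : sgraph) (a q : nat) (U : {set G}) :
  0 < a ->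
  (forall I : {set G}, independent I -> #|I| <= a) ->
  (forall z w : G, adj z w -> #|nbhd z :&: nbhd w| <= a) ->
  #|G| ^ 2 * a ^ q <= #|U| ^ q ->
  \sum_z #|U :&: nbhd z| ^ q <= 2 * a * #|U| ^ q.
Proof.
move=> a0 indep_le codeg_le Ubig.
have -> : \sum_z #|U :&: nbhd z| ^ q = \sum_(z in [set: G]) #|U :&: nbhd z| ^ q.
  by apply: eq_bigl => z; rewrite inE.
apply: leq_trans (moment_bound q U [set: G] indep_le) _.
rewrite mul2n -addnn mulnDl leq_add2l.
apply: (@leq_trans (#|U| ^ q)); last by rewrite leq_pmull.
apply: leq_trans Ubig.
have -> : #|G| ^ 2 * a ^ q = \sum_(z in [set: G]) \sum_(w in [set: G]) a ^ q.
  by rewrite !sum_nat_const cardsT mulnA.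
apply: leq_sum => z _; rewrite big_mkcondr /=; apply: leq_sum => w _.
case: ifP => // zw; case: q => [|q] //; rewrite leq_exp2r //.
apply: leq_trans (codeg_le _ _ zw); apply: subset_leq_card.
by rewrite -setIA subsetIr.
Qed.

(** * Counting sets with many common neighbours *)

Lemma common_nbhdU1 (G : sgraph) (z : G) (A : {set G}) :
  common_nbhd (z |: A) = nbhd z :&: common_nbhd A.
Proof.
rewrite /common_nbhd; apply/setP => y; rewrite !inE.
apply/bigcapP/andP => [H|[zy /bigcapP H] w /setU1P[->|/H//]].
  split; first by have /H := setU11 z A; rewrite inE.
  by apply/bigcapP => w wA; apply: H; rewrite setU1r.
by rewrite inE.
Qed.

Definition rich_in (G : sgraph) (P : pred {set G}) (m : nat) (U : {set G}) :
    {set {set G}} :=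
  [set A : {set G} | (#|A| == m) && P (U :&: common_nbhd A)].

Lemma card_rich_in0 (G : sgraph) (P : pred {set G}) (U : {set G}) :
  #|rich_in P 0 U| = P U.
Proof.
have nb0 : common_nbhd (set0 : {set G}) = [set: G] by rewrite /common_nbhd big_set0.
case PU : (P U).
  rewrite (_ : rich_in P 0 U = [set set0]) ?cards1 //.
  apply/setP => A; rewrite !inE cards_eq0.
  by case: eqP => //= ->; rewrite nb0 setIT.
apply: eq_card0 => A; rewrite !inE cards_eq0.
by case: eqP => //= ->; rewrite nb0 setIT.
Qed.

(** Removing a vertex [z] from [A] and intersecting [U] with its neighbourhood leaves the common
    neighbourhood inside [U] unchanged. This is why [U] is a parameter of [rich_in]. *)
Lemma card_rich_inS (G : sgraph) (P : pred {set G}) (m : nat) (U : {set G}) :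
  #|rich_in P m.+1 U| <= \sum_z #|rich_in P m (U :&: nbhd z)|.
Proof.
pose B z := [set z |: (A : {set G}) | A in rich_in P m (U :&: nbhd z)].
apply: (@leq_trans #|\bigcup_z B z|); last first.
  apply: (@leq_trans (\sum_z #|B z|)).
    elim/big_rec2 : _ => [|z s C _ IH]; first by rewrite cards0.
    by rewrite cardsU (leq_trans (leq_subr _ _)) // leq_add2l.
  by apply: leq_sum => z _; apply: leq_imset_card.
apply/subset_leq_card/subsetP => A; rewrite inE => /andP[/eqP cA PA].
have /card_gt0P[z zA] : 0 < #|A| by rewrite cA.
apply/bigcupP; exists z => //; apply/imsetP; exists (A :\ z); last by rewrite setD1K.
rewrite inE -setIA -common_nbhdU1 setD1K // PA andbT.
by move: (cardsD1 z A); rewrite zA cA add1n => -[->].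
Qed.

(* The bound [|U| >= a n^(2/2^j)], with roots cleared. *)
Definition rich (G : sgraph) (a j : nat) : pred {set G} :=
  fun U => #|G| ^ 2 * a ^ (2 ^ j) <= #|U| ^ (2 ^ j).

(** The second hypothesis says [(u / a)^Q <= n^2], so one of the two factors [(u / a)^Q] in the
    bound of order [2Q] can be traded for [n^2]. *)
Lemma halve_exponent (n a u c M Q e : nat) :
  0 < a -> u ^ Q <= n ^ 2 * a ^ Q ->
  n ^ 2 * c * a ^ (2 * Q) <= M * u ^ (2 * Q) * n ^ (2 * e) ->
  n ^ 2 * c * a ^ Q <= M * u ^ Q * n ^ (2 * e.+1).
Proof.
move=> a0 uQ H.
rewrite -(@leq_pmul2r (a ^ Q)) ?expn_gt0 ?a0 //.
rewrite -mulnA -expnD addnn -mul2n; apply: leq_trans H _.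
rewrite mul2n -addnn expnD mulnS expnD.
rewrite [leqRHS](_ : _ = M * (u ^ Q * (n ^ 2 * a ^ Q)) * n ^ (2 * e)).
  by rewrite leq_mul // leq_mul // leq_mul.
by nia.
Qed.

(* The right-hand side is valid for every [i <= j]; the best choice is the scale
   [a n^(2/2^i) <= |U| <= a n^(2/2^(i-1))], where the moment of order [2^i] is
   available, and [halve_exponent] moves to it from smaller [i]. *)
Lemma card_rich_in_le (G : sgraph) (a j : nat) :
  0 < a ->
  (forall I : {set G}, independent I -> #|I| <= a) ->
  (forall z w : G, adj z w -> #|nbhd z :&: nbhd w| <= a) ->
  forall (m e i : nat) (U : {set G}), i + e = j ->
  #|G| ^ 2 * #|rich_in (rich a j) m U| * a ^ (2 ^ i) <=
  (2 * a) ^ m * #|U| ^ (2 ^ i) * #|G| ^ (2 * e).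
Proof.
move=> a0 indep_le codeg_le.
elim=> [|m IHm]; elim=> [|e IHe] i U ij.
- rewrite card_rich_in0 mul1n muln0 expn0 muln1.
  by case: (boolP (rich a j U)); rewrite ?muln0 // muln1 /rich -ij addn0.
- have [Ubig|Usmall] := leqP (#|G| ^ 2 * a ^ (2 ^ i)) (#|U| ^ (2 ^ i)).
    rewrite card_rich_in0 mul1n -[leqLHS]mulnAC.
    have [G0|G0] := posnP #|G|; first by rewrite G0 !mul0n.
    by rewrite leq_mul // (leq_trans (leq_b1 _)) // expn_gt0 G0 //.
  apply: halve_exponent (ltnW Usmall) _ => //.
  by rewrite -expnS; apply: IHe; rewrite addSnnS.
- have [Ubig|Usmall] := leqP (#|G| ^ 2 * a ^ (2 ^ i)) (#|U| ^ (2 ^ i)); last first.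
    (* Here [i = j], so a small [U] is not rich and neither is any subset of it. *)
    suff -> : #|rich_in (rich a j) m.+1 U| = 0 by rewrite muln0.
    apply: eq_card0 => A; rewrite !inE /rich -ij addn0; apply/negbTE.
    rewrite negb_and -ltnNge orbC (leq_ltn_trans _ Usmall) //.
    case: (2 ^ i) => // q; rewrite leq_exp2r //.
    by rewrite subset_leq_card ?subsetIl.
  apply: (@leq_trans (\sum_z #|G| ^ 2 * #|rich_in (rich a j) m (U :&: nbhd z)| * a ^ (2 ^ i))).
    by rewrite -big_distrl -big_distrr /= leq_mul // leq_mul // card_rich_inS.
  apply: (@leq_trans (\sum_z (2 * a) ^ m * #|U :&: nbhd z| ^ (2 ^ i) * #|G| ^ (2 * 0))).
    by apply: leq_sum => z _; apply: IHm.
  rewrite -big_distrl -big_distrr /= leq_mul // expnSr -mulnA leq_mul //.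
  exact: moment_le.
(* A small [U] inherits the bound from the next scale [i + 1]. For a large one the induction on [m]
   is applied to each [U :&: nbhd z], and the moment of order [2^i] sums the results. *)
- have [Ubig|Usmall] := leqP (#|G| ^ 2 * a ^ (2 ^ i)) (#|U| ^ (2 ^ i)); last first.
    apply: halve_exponent (ltnW Usmall) _ => //.
    by rewrite -expnS; apply: IHe; rewrite addSnnS.
  apply: (@leq_trans (\sum_z #|G| ^ 2 * #|rich_in (rich a j) m (U :&: nbhd z)| * a ^ (2 ^ i))).
    by rewrite -big_distrl -big_distrr /= leq_mul // leq_mul // card_rich_inS.
  apply: (@leq_trans (\sum_z (2 * a) ^ m * #|U :&: nbhd z| ^ (2 ^ i) * #|G| ^ (2 * e.+1))).
    by apply: leq_sum => z _; apply: IHm.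
  rewrite -big_distrl -big_distrr /= leq_mul // expnSr -mulnA leq_mul //.
  exact: moment_le.
Qed.

Lemma card_rich_le (G : sgraph) (a j m : nat) :
  0 < #|G| -> 0 < a ->
  (forall I : {set G}, independent I -> #|I| <= a) ->
  (forall z w : G, adj z w -> #|nbhd z :&: nbhd w| <= a) ->
  #|rich_in (rich a j) m [set: G]| <= (2 * a) ^ m * #|G| ^ (2 * j).
Proof.
move=> G0 a0 indep_le codeg_le.
have := card_rich_in_le a0 indep_le codeg_le m [set: G] (add0n j).
rewrite cardsT !expn1 => H.
rewrite -(leq_pmul2r G0) mulnAC; apply: leq_trans _ H.
(* The scale [i = 0] leaves a spare factor [n a >= 1], which is dropped. *)
set r := #|_|; rewrite [leqRHS](_ : _ = r * #|G| * (#|G| * a)); last by nia.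
by rewrite leq_pmulr // muln_gt0 G0.
Qed.

(** * Counting functions one value at a time *)

Local Open Scope ring_scope.

(** Functions are built along [s]: once the values on the prefix [s1] are fixed, at most [D x]
    values remain for [x]. The induction splits [Phi] by the value at the head of [s], and the
    agreement outside [s] leaves a single function at the end. *)
Lemma card_sequential (T V : finType) (R : numDomainType) (D : T -> R)
    (s : seq T) (Phi : {set {ffun T -> V}}) :
  (forall x, 0 <= D x) ->
  (forall f g, f \in Phi -> g \in Phi -> forall y, y \notin s -> f y = g y) ->
  (forall s1 x s2 f, s = s1 ++ x :: s2 -> f \in Phi ->
     #|[set (g : {ffun T -> V}) x |
         g in [set g in Phi | all (fun y => g y == f y) s1]]|%:R <= D x) ->
  #|Phi|%:R <= \prod_(x <- s) D x.
Proof.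
move=> D0; elim: s Phi => [|x s IHs] Phi agree step.
  rewrite big_nil (ler_nat _ _ 1); apply/card_le1_eqP => f g fP gP.
  by apply/ffunP => y; apply: agree.
have [->|[f0 f0P]] := set_0Vmem Phi.
  by rewrite cards0; apply: prodr_ge0.
pose im := [set (g : {ffun T -> V}) x | g in Phi].
pose Phiv v := [set g in Phi | g x == v].
have -> : #|Phi| = (\sum_(v in im) #|Phiv v|)%N.
  rewrite -sum1_card (partition_big (fun f : {ffun T -> V} => f x) (mem im)) /=; last first.
    by move=> f fP; apply: imset_f.
  by apply: eq_bigr => v _; rewrite -sum1_card; apply: eq_bigl => f; rewrite inE.
rewrite natr_sum big_cons.
apply: (@le_trans _ _ (\sum_(v in im) \prod_(y <- s) D y)).
  apply: ler_sum => v _; apply: IHs => [f g|s1 y s2 f sE].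
    rewrite !inE => /andP[fP /eqP fx] /andP[gP /eqP gx] y ys.
    have [->|yx] := eqVneq y x; first by rewrite fx gx.
    by apply: agree => //; rewrite inE negb_or yx.
  rewrite inE => /andP[fP /eqP fx].
  have := step (x :: s1) y s2 f; rewrite sE => /(_ erefl fP); apply: le_trans.
  rewrite ler_nat subset_leq_card //; apply/fintype.subsetP => w /imsetP[g].
  rewrite !inE => /andP[/andP[gP /eqP gx] gf] ->; apply: imset_f.
  by rewrite inE gP /= fx gx eqxx.
rewrite sumr_const -[leLHS]mulr_natl ler_wpM2r ?prodr_ge0 //.
have := step [::] x s f0 erefl f0P; rewrite (_ : [set g in Phi | _] = Phi) //.
by apply/setP => g; rewrite inE andbT.
Qed.

(** * Averages over vertex orders *)

(** In a uniformly random order, this is the expected [phi] of the number of neighbours preceding a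
    vertex of degree [d]. *)
Definition avg (R : realFieldType) (phi : nat -> R) (d : nat) : R :=
  (\sum_(m < d.+1) phi m) / d.+1%:R.

Lemma avg_rec (R : realFieldType) (phi : nat -> R) (d : nat) :
  phi d + avg phi d.-1 *+ d = avg phi d *+ d.+1.
Proof.
rewrite -[_ *+ d]mulr_natr -[_ *+ d.+1]mulr_natr /avg.
rewrite divfK ?pnatr_eq0 // [RHS]big_ord_recr [RHS]addrC.
congr (_ + _); case: d => [|d]; first by rewrite big_ord0 mulr0.
by rewrite -pred_Sn divfK ?pnatr_eq0.
Qed.

Definition back_degree (T : eqType) (e : rel T) (s : seq T) (x : T) : nat :=
  count (e x) (take (index x s) s).

(** The expected cost of [y], split by the last vertex of the order: [y] itself gives [phi d], each
    of its [d] neighbours gives the average for [d - 1], every other vertex the average for [d]. The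
    first two kinds combine by [avg_rec]. *)
Lemma avg_remove (T : finType) (R : realFieldType) (e : rel T) (phi : nat -> R)
    (X : {set T}) (y : T) :
  irreflexive e -> y \in X ->
  phi #|X :&: [set z | e y z]| +
    \sum_(x in X :\ y) avg phi #|(X :\ x) :&: [set z | e y z]| =
  avg phi #|X :&: [set z | e y z]| *+ #|X|.
Proof.
move=> e_irr yX; set d := #|_|.
have dE : #|[set x in X :\ y | e y x]| = d.
  apply: eq_card => x; rewrite !inE; have [->|] := eqVneq x y => //=.
  by rewrite e_irr andbF.
rewrite (bigID (e y)) /= addrA.
rewrite (eq_bigr (fun=> avg phi d.-1)); last first.
  move=> x /andP[/setD1P[xy xX] yx]; congr avg.
  rewrite /d (cardsD1 x (X :&: _)) !inE xX yx add1n /=.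
  by apply: eq_card => z; rewrite !inE andbA.
rewrite [X in _ + X](eq_bigr (fun=> avg phi d)); last first.
  move=> x /andP[/setD1P[xy xX] /negbTE yx]; congr avg.
  apply: eq_card => z; rewrite !inE; have [->|] := eqVneq z x => //=.
  by rewrite yx andbF.
rewrite !sumr_const.
rewrite (_ : #|_| = d); last by rewrite -dE; apply: eq_card => x; rewrite [RHS]inE unfold_in.
rewrite avg_rec -mulrnDr; congr (_ *+ _).
have := cardsID [set z | e y z] (X :\ y).
rewrite (cardsD1 y X) yX -dE => <-.
rewrite addSn add1n; congr (_ + _).+1%N.
  by apply: eq_card => z; rewrite !inE.
by apply: eq_card => z; rewrite unfold_in !inE andbC.
Qed.

(* The average over the last vertex of the order is computed exactly, as in the
   proof of the Caro-Wei bound. *)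
Lemma exists_order (T : finType) (R : realFieldType) (e : rel T)
    (phi : nat -> R) (X : {set T}) :
  irreflexive e ->
  exists s : seq T,
  [/\ uniq s, s =i X &
   \sum_(x <- s) phi (back_degree e s x) <=
   \sum_(x in X) avg phi #|X :&: [set y | e x y]|].
Proof.
move=> e_irr; have [h hX] := ubnP #|X|; elim: h X hX => // h IHh X hX.
have [->|[x0 x0X]] := set_0Vmem X.
  by exists [::]; split => [|y|] //; rewrite ?inE // big_nil big_set0.
(* [A x] bounds the cost when [x] comes last: all its neighbours in [X] precede it, and the rest is
   ordered by induction. The mean of [A] over [X] is [B]. *)
pose A x := phi #|X :&: [set z | e x z]| +
   \sum_(y in X :\ x) avg phi #|(X :\ x) :&: [set z | e y z]|.
pose B := \sum_(x in X) avg phi #|X :&: [set y | e x y]|.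
have AB : \sum_(x in X) A x = \sum_(x in X) B.
  rewrite big_split /=.
  rewrite (exchange_big_dep (mem X)) /=; last by move=> x y _ /setD1P[].
  rewrite -big_split /= sumr_const -sumrMnl; apply: eq_bigr => y yX.
  rewrite -(avg_remove phi e_irr yX); congr (_ + _).
  apply: eq_bigl => x; rewrite !inE yX andbT eq_sym.
  by rewrite andbC.
have [x xX Ax] : exists2 x, x \in X & A x <= B.
  apply/exists_inP; apply: contra_eqT AB; rewrite negb_exists_in => /forall_inP H.
  rewrite gt_eqF //; apply: ltr_sum => [|x xX]; last by rewrite ltNge H.
  by apply/hasP; exists x0; first exact: mem_index_enum.
have [|s [us sX sle]] := IHh (X :\ x).
  by move: hX; rewrite (cardsD1 x X) xX.
have xs : x \notin s by rewrite sX !inE eqxx.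
exists (rcons s x); split.
- by rewrite rcons_uniq xs.
- by move=> y; rewrite mem_rcons inE sX !inE; have [->|] := eqVneq y x.
apply: le_trans Ax; rewrite big_rcons /= [leLHS]addrC; apply: lerD.
  rewrite /back_degree -cats1 index_cat (negbTE xs) /= eqxx addn0 take_size_cat //.
  have -> // : count (e x) s = #|X :&: [set z | e x z]|.
  rewrite -size_filter -(card_uniqP _) ?filter_uniq //.
  apply: eq_card => y; rewrite mem_filter sX !inE andbC.
  by have [->|] := eqVneq y x; rewrite ?e_irr ?andbF.
apply: le_trans sle; rewrite le_eqVlt; apply/orP; left; apply/eqP.
rewrite big_seq [RHS]big_seq; apply: eq_bigr => y ys.
congr (phi _); rewrite /back_degree -cats1 index_cat ys takel_cat //.
by rewrite ltnW // index_mem.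
Qed.

(** * Random vertex sets and deletion *)

(** The probability that a [p]-random set, given by its indicator [f], contains [A]. Independence
    appears as distributivity of the product over the sum. *)
Lemma weight_subset (V : finType) (R : comPzRingType) (p : R) (A : {set V}) :
  \sum_(f : {ffun V -> bool}) (\prod_x (if f x then p else 1 - p)) *
     (A \subset [set x | f x])%:R = p ^+ #|A|.
Proof.
pose F (x : V) (b : bool) := if b then p else if x \in A then 0 else 1 - p.
transitivity (\sum_(f : {ffun V -> bool}) \prod_x F x (f x)).
  apply: eq_bigr => f _; case: fintype.subsetP => [Af|/fintype.subsetP].
    rewrite mulr1; apply: eq_bigr => x _; rewrite /F; case fx : (f x) => //.
    by case: ifP => // /Af; rewrite inE fx.
  case/subsetPn => x xA; rewrite inE => /negbTE fx.
  by rewrite mulr0 (bigD1 x) //= /F fx xA mul0r.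
rewrite -bigA_distr_bigA /=.
transitivity (\prod_(x in A) p); last by rewrite prodr_const.
rewrite [RHS]big_mkcond; apply: eq_bigr => x _.
rewrite big_bool /F; case: (x \in A) => /=; first by rewrite addr0.
by rewrite addrC subrK.
Qed.

Lemma exists_transversal (V : finType) (Fam : {set {set V}}) :
  set0 \notin Fam ->
  exists2 D : {set V}, (#|D| <= #|Fam|)%N & forall A, A \in Fam -> ~~ [disjoint A & D].
Proof.
move=> Fam0; pose pt (A : {set V}) := if [pick x in A] is Some x then [set x] else set0.
exists (\bigcup_(A in Fam) pt A).
  rewrite -[leqRHS]sum1_card; elim/big_rec2 : _ => [|A n D _ IH]; first by rewrite cards0.
  rewrite cardsU (leq_trans (leq_subr _ _)) // leq_add //.
  by rewrite /pt; case: pickP => [x _|_]; rewrite ?cards1 ?cards0.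
move=> A AF; have [x xA ptA] : exists2 x, x \in A & pt A = [set x].
  rewrite /pt; case: pickP => [x xA|/= A0]; first by exists x.
  suff A_0 : A = set0 by rewrite -A_0 AF in Fam0.
  by apply/setP => y; rewrite A0 inE.
apply/pred0Pn; exists x; rewrite /= xA; apply/bigcupP; exists A => //.
by rewrite ptA set11.
Qed.

(** The deletion method: some outcome of the [p]-random set reaches the expectation of its size
    minus the number of members of [Fam] inside it, and one vertex of each such member is then
    removed. *)
Lemma exists_large_avoiding_set (V : finType) (R : realDomainType) (p : R) (Fam : {set {set V}}) :
  0 <= p <= 1 -> set0 \notin Fam ->
  exists2 S : {set V}, p *+ #|V| - \sum_(A in Fam) p ^+ #|A| <= #|S|%:R &
    forall A, A \in Fam -> ~~ (A \subset S).
Proof.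
move=> /andP[p0 p1] Fam0.
pose w (f : {ffun V -> bool}) := \prod_x (if f x then p else 1 - p).
have w0 f : 0 <= w f by apply: prodr_ge0 => x _; case: ifP; rewrite ?subr_ge0.
pose val (f : {ffun V -> bool}) : R :=
  #|[set x | f x]|%:R - #|[set A in Fam | A \subset [set x | f x]]|%:R.
pose E := p *+ #|V| - \sum_(A in Fam) p ^+ #|A|.
have w1 : \sum_f w f = 1.
  rewrite -[RHS](expr0 p) -(cards0 V) -weight_subset.
  by apply: eq_bigr => f _; rewrite sub0set mulr1.
have wE : \sum_f w f * val f = E.
  under eq_bigr => f _ do rewrite /val mulrBr.
  rewrite sumrB; congr (_ - _).
    transitivity (\sum_f \sum_(x : V) w f * ([set x] \subset [set x | f x])%:R).
      apply: eq_bigr => f _; rewrite -mulr_sumr -natr_sum -sum1_card; congr (_ * _%:R).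
      by rewrite big_mkcond; apply: eq_bigr => x _; rewrite sub1set; case: ifP.
    rewrite exchange_big /=; under eq_bigr => x _ do rewrite weight_subset cards1 expr1.
    by rewrite sumr_const.
  transitivity (\sum_f \sum_(A in Fam) w f * (A \subset [set x | f x])%:R).
    apply: eq_bigr => f _; rewrite -mulr_sumr -natr_sum -sum1_card; congr (_ * _%:R).
    rewrite big_mkcond [RHS]big_mkcond /=; apply: eq_bigr => A _.
    by rewrite inE; case: (A \in Fam) => //=; case: (A \subset _).
  by rewrite exchange_big /=; apply: eq_bigr => A _; rewrite weight_subset.
have [f Ef] : exists f, E <= val f.
  (* If every value were below the mean [E], the vanishing weighted sum of the positive gaps would
     force all weights to be zero, although they sum to one. *)
  have [//|/forallNP valE] := pselect (exists f, E <= val f).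
  have gap f : 0 < E - val f by rewrite subr_gt0 ltNge; apply/negP/valE.
  have /psumr_eq0P w_eq0 : \sum_f w f * (E - val f) = 0.
    under eq_bigr => f _ do rewrite mulrBr.
    by rewrite sumrB wE -mulr_suml w1 mul1r subrr.
  have {}w_eq0 f : w f = 0.
    apply/eqP; have /eqP := w_eq0 (fun f _ => mulr_ge0 (w0 f) (ltW (gap f))) f isT.
    by rewrite mulf_eq0 (gt_eqF (gap f)) orbF.
  by move/eqP: w1; rewrite big1 // eq_sym oner_eq0.
pose S := [set x | f x]; pose bad := [set A in Fam | A \subset S].
have [|D Dle Dbad] := @exists_transversal V bad.
  by rewrite inE (negbTE Fam0).
exists (S :\: D); last first.
  move=> A AF; apply/negP; rewrite subsetD => /andP[AS].
  by apply/negP/Dbad; rewrite inE AF.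
apply: le_trans Ef _; rewrite /val -/S -/bad lerBlDr -natrD ler_nat.
by rewrite -(cardsID D S) addnC leq_add2l (leq_trans _ Dle) // subset_leq_card // subsetIr.
Qed.

(** * Numerical and graph preliminaries *)

Lemma sum_half_le (R : realFieldType) (k d : nat) : (0 < k)%N ->
  \sum_(m < d) 2^-1 ^+ (m %/ k) <= 2 * k%:R :> R.
Proof.
move=> k0; apply: (@le_trans _ _ (\sum_(m < d * k) 2^-1 ^+ (m %/ k))).
  rewrite -!(big_mkord predT (fun m : nat => 2^-1 ^+ (m %/ k))).
  rewrite [leRHS](big_cat_nat (n := d)) //= ?leq_pmulr // lerDl.
  by apply: sumr_ge0 => m _; rewrite exprn_ge0 // invr_ge0 ler0n.
elim: d => [|d IHd]; first by rewrite mul0n big_ord0 mulr_ge0 // ler0n.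
rewrite mulSn big_split_ord /=.
rewrite (eq_bigr (fun=> 1)) => [|i _]; last by rewrite divn_small.
rewrite sumr_const card_ord.
under eq_bigr => i _ do rewrite divnDl // divnn k0 add1n exprS.
rewrite -mulr_sumr; have := IHd; lra.
Qed.

Lemma min_degree_le (G : sgraph) (v : G) : (min_degree G <= degree v)%N.
Proof.
rewrite /min_degree; have : v \in index_enum G by rewrite mem_index_enum.
elim: (index_enum G) => //= w s IHs; rewrite inE big_cons geq_min.
by case/predU1P => [->|/IHs ->]; rewrite ?leqnn ?orbT.
Qed.

Definition copy_in (F G : sgraph) (S : {set G}) (f : F -> G) : Prop :=
  [/\ injective f, forall x y, adj x y -> adj (f x) (f y) & forall x, f x \in S].

Lemma subgraph_free_induced (F G : sgraph) (S : {set G}) :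
  (forall f : F -> G, ~ copy_in S f) -> subgraph_free F (Defs.induced S).
Proof.
move=> noF [f [f_inj f_hom]]; apply: (noF (fun x => val (f x))); split.
- by move=> x y /val_inj /f_inj.
- by move=> x y /f_hom.
- by move=> x; apply: valP.
Qed.

(** Two adjacent common neighbours of [z] and [w] would complete a [K_4], so the common
    neighbourhood is independent. *)
Lemma codegree_le (G : sgraph) (a : nat) :
  subgraph_free (complete_graph 4) G ->
  (forall I : {set G}, independent I -> (#|I| <= a)%N) ->
  forall z w : G, adj z w -> (#|nbhd z :&: nbhd w| <= a)%N.
Proof.
move=> K4free indep_le z w zw; apply: indep_le => x y.
rewrite !inE => /andP[zx wx] /andP[zy wy]; apply/negP => xy.
apply: K4free; pose h (i : 'I_4) := nth z [:: z; w; x; y] i.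
have h_hom (i j : 'I_4) : i != j -> adj (h i) (h j).
  case: i => -[|[|[|[|//]]]] ?; case: j => -[|[|[|[|//]]]] ?; rewrite /h //= => _;
  by rewrite // adj_sym.
exists h; split => // i j hij; apply/eqP; apply: contraT => /h_hom.
by rewrite hij adj_irrefl.
Qed.

Lemma exists_max_independent (G : sgraph) :
  exists2 I0 : {set G}, independent I0 &
    forall I : {set G}, independent I -> (#|I| <= #|I0|)%N.
Proof.
have P0 : `[< independent (set0 : {set G}) >].
  by apply/asboolP => x y; rewrite inE.
have [I0 /asboolP I0i I0max] := @arg_maxnP _ set0
  (fun I : {set G} => `[< independent I >]) (fun I : {set G} => #|I|) P0.
by exists I0 => // I /asboolP /I0max.
Qed.

(** * Copies without rich subsets *)

(** Only these copies need counting: any other copy disappears together with a rich set contained in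
    it. *)
Definition sparse_copies (F G : sgraph) (a k : nat) : {set {ffun F -> G}} :=
  [set f : {ffun F -> G} | `[< [/\ injective f,
     forall x y, adj x y -> adj (f x) (f y) &
     forall (j : nat) (A : {set G}), (0 < j)%N -> A \subset f @: [set: F] ->
       A \notin rich_in (rich a j) (j * k) [set: G] ] >]].

Lemma le_powR_root (R : realType) (n a u Q : nat) : (0 < Q)%N ->
  (u ^ Q <= n ^ 2 * a ^ Q)%N -> u%:R <= a%:R * n%:R `^ (2 / Q%:R) :> R.
Proof.
move=> Q0 uQ.
rewrite -(@ler_pXn2r _ Q) // ?nnegrE ?mulr_ge0 ?powR_ge0 //.
rewrite exprMn -[_ `^ _ ^+ _]powR_mulrn ?powR_ge0 // -powRrM divfK ?pnatr_eq0 -?lt0n //.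
by rewrite powR_mulrn // -!natrX -natrM ler_nat mulnC.
Qed.

(** The image of [x] is a common neighbour of the images of its earlier neighbours. Some [j * k] of
    these, where [j] is their number divided by [k], form a set that is not rich. *)
Lemma card_sparse_copies (R : realType) (F G : sgraph) (a k : nat) (s : seq F) :
  (0 < k)%N -> (0 < a)%N -> uniq s -> s =i [set: F] ->
  #|sparse_copies F G a k|%:R <=
  \prod_(x <- s) (a%:R * #|G|%:R `^ (2 * 2^-1 ^+ (back_degree (@adj F) s x %/ k))) :> R.
Proof.
move=> k0 a0 us sT; apply: card_sequential => [x|f g _ _ y|s1 x s2 f sE].
- by rewrite mulr_ge0 // powR_ge0.
- by rewrite sT inE.
rewrite inE => /asboolP[f_inj f_hom f_sparse].
have xs1 : x \notin s1.
  by move: us; rewrite sE cat_uniq /= negb_or => /and3P[_ /andP[]].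
have us1 : uniq s1 by move: us; rewrite sE cat_uniq => /andP[].
set j := (_ %/ k)%N.
have jE : j = (count (adj x) s1 %/ k)%N.
  rewrite /j /back_degree sE index_cat (negbTE xs1) /= eqxx addn0.
  by rewrite take_size_cat.
pose P := [set y in take (j * k) [seq y <- s1 | adj x y]].
have cP : #|P| = (j * k)%N.
  rewrite cardsE (card_uniqP _) ?take_uniq ?filter_uniq // size_take_min.
  by apply/minn_idPl; rewrite size_filter jE leq_trunc_div.
pose A := f @: P.
have cA : #|A| = (j * k)%N by rewrite card_imset.
apply: (@le_trans _ _ #|common_nbhd A|%:R).
  rewrite ler_nat subset_leq_card //; apply/fintype.subsetP => w /imsetP[g].
  rewrite !inE => /andP[/asboolP[_ g_hom _] /allP gf] ->.
  apply/bigcapP => z /imsetP[y]; rewrite inE => /mem_take.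
  rewrite mem_filter => /andP[xy /gf /eqP gy ->]; rewrite inE -gy.
  by apply: g_hom; rewrite adj_sym.
rewrite exprVn -natrX; apply: le_powR_root; first by rewrite expn_gt0.
(* For [j = 0] sparseness says nothing, but the claim is only [n <= n^2 a]. *)
have [j0|j0] := posnP j.
  rewrite j0 !expn1 (leq_trans (max_card _)) //.
  by have [->//|G0] := posnP #|G|; nia.
apply: ltnW; rewrite ltnNge.
have := f_sparse j A j0 (imsetS _ (subsetT _)).
by rewrite inE cA eqxx setTI.
Qed.

(** By [sum_half_le] a vertex of degree [d] has average exponent at most [2 (2k) / (d + 1)], and
    [d >= t]. *)
Lemma exists_good_order (R : realFieldType) (F : sgraph) (k t : nat) :
  (0 < k)%N -> (t <= min_degree F)%N ->
  exists s : seq F, [/\ uniq s, s =i [set: F] &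
   \sum_(x <- s) 2 * 2^-1 ^+ (back_degree (@adj F) s x %/ k) <=
     #|F|%:R * (4 * k%:R / t.+1%:R) :> R].
Proof.
move=> k0 tF; pose phi m : R := 2 * 2^-1 ^+ (m %/ k).
have [s [us sT sle]] := exists_order phi [set: F] (@adj_irrefl F).
exists s; split => //; apply: le_trans sle _.
rewrite mulr_natl -cardsT -sumr_const; apply: ler_sum => x _.
rewrite /avg setTI (_ : #|_| = degree x); last first.
  by rewrite /degree; apply: eq_card => y; rewrite !inE.
rewrite -mulr_sumr; apply: ler_pM; rewrite ?invr_ge0 ?ler0n //.
- by rewrite mulr_ge0 // sumr_ge0 // => m _; rewrite exprn_ge0 // invr_ge0.
- by have := sum_half_le R (degree x).+1 k0; lra.
- rewrite lef_pV2 ?posrE ?ltr0n // ler_nat ltnS.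
  exact: leq_trans tF (min_degree_le x).
Qed.

(** * Expected numbers of surviving objects *)

Lemma ler_sum_setU (T : finType) (R : numDomainType) (g : T -> R) (B C : {set T}) :
  (forall x, 0 <= g x) ->
  \sum_(x in B :|: C) g x <= \sum_(x in B) g x + \sum_(x in C) g x.
Proof.
move=> g0; rewrite !(big_mkcond (fun x => x \in _)) -big_split; apply: ler_sum => x _.
by rewrite inE; do 2![case: (x \in _)]; rewrite /= ?addr0 ?add0r // lerDl.
Qed.

Lemma ler_sum_bigcup (T I : finType) (R : numDomainType) (g : T -> R)
    (P : pred I) (B : I -> {set T}) :
  (forall x, 0 <= g x) ->
  \sum_(x in \bigcup_(i | P i) B i) g x <= \sum_(i | P i) \sum_(x in B i) g x.
Proof.
move=> g0; elim/big_rec2 : _ => [|i y C _ IH]; first by rewrite big_set0.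
by apply: le_trans (ler_sum_setU _ _ g0) _; rewrite lerD2l.
Qed.

Lemma prod_powR (R : realType) (T : Type) (s : seq T) (x : R) (r : T -> R) :
  x != 0 -> \prod_(i <- s) x `^ r i = x `^ (\sum_(i <- s) r i).
Proof.
move=> x0; rewrite (big_morph _ (id1 := 1) (op1 := *%R)) ?powRr0 //.
by move=> u v; rewrite powRD // x0 implybT.
Qed.

(** With [m = j k], [card_rich_le] gives at most [(2 p a)^m n^(2j) <= (2c)^m n^(2j - 2 eta m)]. The
    power of [n] is at most one because [eta k >= 1], and [m >= 2] because [k > 1]. *)
Lemma card_rich_weight_le (R : realType) (G : sgraph) (a j k : nat) (c eta p : R) :
  (0 < #|G|)%N -> (0 < a)%N -> (0 < j)%N -> (1 < k)%N ->
  (forall I : {set G}, independent I -> (#|I| <= a)%N) ->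
  (forall z w : G, adj z w -> (#|nbhd z :&: nbhd w| <= a)%N) ->
  0 <= p -> 0 <= c -> 2 * c <= 1 -> 1 <= eta * k%:R ->
  p * a%:R <= c * #|G|%:R `^ (- (2 * eta)) ->
  #|rich_in (rich a j) (j * k) [set: G]|%:R * p ^+ (j * k) <= (2 * c) ^+ 2.
Proof.
move=> G0 a0 j0 k1 indep_le codeg_le p0 c0 c1 eta_k pa.
set N : R := #|G|%:R; set m := (j * k)%N.
have N1 : 1 <= N by rewrite ler1n.
have Nn0 : N != 0 by rewrite gt_eqF // (lt_le_trans _ N1).
apply: (@le_trans _ _ ((2 * a%:R) ^+ m * N ^+ (2 * j) * p ^+ m)).
  rewrite ler_wpM2r ?exprn_ge0 // /N -natrX -natrM -natrX -natrM ler_nat.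
  exact: card_rich_le.
rewrite mulrAC -exprMn.
apply: (@le_trans _ _ ((2 * c * N `^ (- (2 * eta))) ^+ m * N ^+ (2 * j))).
  rewrite ler_wpM2r ?exprn_ge0 ?(le_trans ler01) //.
  rewrite lerXn2r ?nnegrE ?mulr_ge0 ?powR_ge0 //.
  by move: pa; rewrite -/N; nra.
rewrite exprMn -mulrA -[leRHS]mulr1; apply: ler_pM.
- by rewrite exprn_ge0 // mulr_ge0.
- by rewrite mulr_ge0 ?exprn_ge0 ?powR_ge0 // (le_trans ler01).
- rewrite ler_wiXn2l ?mulr_ge0 //.
  by rewrite (leq_trans k1) // leq_pmull.
rewrite -!powR_mulrn ?powR_ge0 ?(le_trans ler01) // -powRrM -powRD ?Nn0 ?implybT //.
rewrite -[leRHS](powRr0 N); apply: ler_powR => //.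
rewrite /m !natrM; have j0' : 0 <= j%:R :> R by [].
by nra.
Qed.

(** Along a good order the exponents of [n] sum to at most [2 eta |F|], which the factor
    [n^(- 2 eta)] in each [p a] cancels. *)
Lemma sparse_copies_weight_le (R : realType) (F G : sgraph) (a k t : nat)
    (c eta p : R) :
  (0 < #|G|)%N -> (0 < a)%N -> (0 < k)%N -> (t <= min_degree F)%N ->
  0 <= p -> 0 <= c -> 4 * k%:R / t.+1%:R <= 2 * eta ->
  p * a%:R <= c * #|G|%:R `^ (- (2 * eta)) ->
  #|sparse_copies F G a k|%:R * p ^+ #|F| <= c ^+ #|F|.
Proof.
move=> G0 a0 k0 tF p0 c0 eta_t pa.
set N : R := #|G|%:R.
have N1 : 1 <= N by rewrite ler1n.
have Nn0 : N != 0 by rewrite gt_eqF // (lt_le_trans _ N1).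
have [s [us sT sle]] := exists_good_order R k0 tF.
have size_s : size s = #|F|.
  by rewrite -(card_uniqP us) -cardsT; apply: eq_card.
apply: le_trans (ler_wpM2r (exprn_ge0 _ p0) (card_sparse_copies R G k0 a0 us sT)) _.
rewrite big_split /= prod_powR // big_const_seq count_predT size_s iter_mulr_1.
rewrite mulrAC -exprMn [a%:R * p]mulrC.
apply: (@le_trans _ _ ((c * N `^ (- (2 * eta))) ^+ #|F| * N `^ (2 * eta * #|F|%:R))).
  apply: ler_pM; rewrite ?powR_ge0 ?exprn_ge0 ?mulr_ge0 //.
    by rewrite lerXn2r ?nnegrE ?mulr_ge0 ?powR_ge0.
  apply: ler_powR => //; apply: le_trans sle _.
  by rewrite mulrC ler_wpM2r.
rewrite exprMn -[_ `^ _ ^+ _]powR_mulrn ?powR_ge0 // -powRrM -[leLHS]mulrA -powRD ?Nn0 ?implybT //.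
by rewrite mulNr addNr powRr0 mulr1.
Qed.

Lemma sampled_set (R : realType) (F G : sgraph) (a k t : nat) (c eta B : R) :
  (0 < #|G|)%N -> (0 < a)%N -> (1 < k)%N -> (1 < #|F|)%N -> (t <= min_degree F)%N ->
  (forall I : {set G}, independent I -> (#|I| <= a)%N) ->
  (forall z w : G, adj z w -> (#|nbhd z :&: nbhd w| <= a)%N) ->
  B = #|G|%:R `^ (2^-1 - eta) -> a%:R <= B ->
  c = ((4 * #|F| + 1) * 2)%:R^-1 ->
  0 <= eta -> 1 <= eta * k%:R -> 4 * k%:R / t.+1%:R <= 2 * eta ->
  exists2 S : {set G}, c / 2 * B <= #|S|%:R & forall f : F -> G, ~ copy_in S f.
Proof.
move=> G0 a0 k1 F1 tF indep_le codeg_le BE aB cE eta0 eta_k eta_t.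
set N : R := #|G|%:R.
have N1 : 1 <= N by rewrite ler1n.
have N0 : 0 <= N by rewrite (le_trans ler01).
have Nn0 : N != 0 by rewrite gt_eqF // (lt_le_trans _ N1).
have B1 : 1 <= B by apply: le_trans aB; rewrite ler1n.
have c0 : 0 < c by rewrite cE invr_gt0 ltr0n; lia.
(* The value of [c] makes the expected loss [|F| (2c)^2 + c^2] equal to [c / 2], at most half of the
   expected size [c B]. *)
have c_h : c * (4 * #|F|%:R + 1) * 2 = 1.
  have -> : c = ((4 * #|F|%:R + 1) * 2)^-1 by rewrite cE natrM natrD natrM.
  by rewrite -mulrA mulVf // lt0r_neq0 //; have : 0 <= #|F|%:R :> R by []; lra.
have F1' : 1 <= #|F|%:R :> R by rewrite ler1n; lia.
have c1 : 2 * c <= 1 by nra.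
(* With this [p], both [p n = c B] and [p B = c n^(- 2 eta)] hold. *)
pose p := c * N `^ (- (2^-1 + eta)).
have p0 : 0 <= p by rewrite mulr_ge0 ?powR_ge0 // ltW.
have p1 : p <= 1.
  rewrite -[leRHS]mulr1; apply: ler_pM; rewrite ?powR_ge0 ?(ltW c0) //; first by lra.
  by rewrite -[leRHS](powRr0 N) ler_powR //; lra.
have pN : p * N = c * B.
  rewrite /p -mulrA BE -/N; congr (_ * _).
  by rewrite -[X in _ * X](powRr1 N0) -powRD ?Nn0 ?implybT //; congr (_ `^ _); lra.
have pa : p * a%:R <= c * N `^ (- (2 * eta)).
  apply: le_trans (_ : p * B <= _); first by rewrite ler_wpM2l.
  rewrite /p BE -mulrA -powRD ?Nn0 ?implybT // ler_wpM2l ?(ltW c0) //.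
  by rewrite ler_powR //; lra.
(* Larger [j] cannot occur, since a set of [j k] vertices inside a copy has at most [|F|] elements;
   [j > 0] keeps the empty set out of the family. *)
pose rich_sets := \bigcup_(j < #|F|.+1 | (0 < j)%N) rich_in (rich a j) (j * k) [set: G].
pose copies := [set (f : {ffun F -> G}) @: [set: F] | f in sparse_copies F G a k].
have card_copy A : A \in copies -> #|A| = #|F|.
  move=> /imsetP[f]; rewrite inE => /asboolP[f_inj _ _] ->.
  by rewrite card_imset // cardsT.
have [||S Sle Sfree] := @exists_large_avoiding_set G R p (rich_sets :|: copies).
- by rewrite p0.
- apply/negP => /setUP[/bigcupP[j j0]|/card_copy]; last first.
    by rewrite cards0 => F_eq0; rewrite -F_eq0 in F1.
  by rewrite inE cards0 eq_sym muln_eq0 !gtn_eqF ?(ltnW k1).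
exists S.
  have : \sum_(A in rich_sets :|: copies) p ^+ #|A| <= #|F|%:R * (2 * c) ^+ 2 + c ^+ 2.
    apply: le_trans (ler_sum_setU _ _ _) _ => [A|]; first exact: exprn_ge0.
    apply: lerD.
      apply: le_trans (ler_sum_bigcup _ _ _) _ => [A|]; first exact: exprn_ge0.
      rewrite big_mkcond big_ord_recl /= add0r mulr_natl -[X in _ *+ X]card_ord -sumr_const.
      apply: ler_sum => j _; set j' := bump 0 j.
      apply: le_trans (card_rich_weight_le (j := j') G0 a0 _ k1 indep_le codeg_le
        p0 _ c1 eta_k pa) => //; last exact: ltW.
      rewrite mulr_natl -sumr_const le_eqVlt; apply/orP; left; apply/eqP.
      by apply: eq_bigr => A; rewrite inE => /andP[/eqP ->].
    rewrite (eq_bigr (fun=> p ^+ #|F|)) => [|A /card_copy -> //].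
    rewrite sumr_const -mulr_natl.
    apply: (@le_trans _ _ (#|sparse_copies F G a k|%:R * p ^+ #|F|)).
      by rewrite ler_wpM2r ?exprn_ge0 // ler_nat leq_imset_card.
    apply: (le_trans (sparse_copies_weight_le G0 a0 (ltnW k1) tF p0 (ltW c0) eta_t pa)).
    by rewrite ler_wiXn2l ?(ltW c0) //; lra.
  move: Sle; rewrite -[p *+ _]mulr_natr -/N pN => Sle sum_le.
  suff : #|F|%:R * (2 * c) ^+ 2 + c ^+ 2 <= c / 2 * B by lra.
  by nra.
move=> f [f_inj f_hom fS].
pose g : {ffun F -> G} := [ffun x => f x].
have gS : g @: [set: F] \subset S.
  by apply/fintype.subsetP => _ /imsetP[x _ ->]; rewrite ffunE.
(* A copy inside [S] is sparse, since a rich subset of its image would lie in [S]; but then the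
   image itself is a forbidden set in [S]. *)
suff gsp : g \in sparse_copies F G a k.
  suff /Sfree : g @: [set: F] \in rich_sets :|: copies by rewrite gS.
  by apply/setUP; right; apply: imset_f.
rewrite inE; apply/asboolP; split=> [x y|x y|j A j0 Ag].
- by rewrite !ffunE => /f_inj.
- by rewrite !ffunE => /f_hom.
apply/negP => Arich; move: (subset_trans Ag gS); apply/negP/Sfree/setUP; left.
have jF : (j < #|F|.+1)%N.
  move: (Arich); rewrite inE => /andP[/eqP cA _].
  rewrite ltnS -cardsT (leq_trans _ (leq_imset_card g _)) //.
  by rewrite (leq_trans _ (subset_leq_card Ag)) // cA leq_pmulr // ltnW.
by apply/bigcupP; exists (Ordinal jF).
Qed.

(** * Choice of parameters and conclusion *)

Lemma large_sparse_set (R : realType) (t : nat) (F : sgraph) :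
  (0 < t)%N -> min_degree F = t ->
  exists2 c : R, 0 < c <= 1 & forall G : sgraph,
    (0 < #|G|)%N -> subgraph_free (complete_graph 4) G ->
    exists2 S : {set G}, c * #|G|%:R `^ (1 / 2 - 6 / Num.sqrt t%:R) <= #|S|%:R &
      forall f : F -> G, ~ copy_in S f.
Proof.
move=> t0 tF; set sq := Num.sqrt _.
have sq1 : 1 <= sq by rewrite -[leLHS]sqrtr1 ler_sqrt ?ltr0n // ler1n.
have sq2 : sq ^+ 2 = t%:R by rewrite sqr_sqrtr.
(* With [eta = 6 / sq], the bound [sq < k] gives [eta k >= 1], and [k <= sq + 1] gives
   [4k/(t+1) <= 2 eta]. *)
pose k := (Num.truncn sq).+1.
have k_gt : sq < k%:R by apply: truncnS_gt.
have k_le : k%:R <= sq + 1.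
  by rewrite /k -natr1 lerD2r truncn_le // (le_trans ler01).
have k1 : (1 < k)%N.
  by rewrite -(ltr_nat R); apply: le_lt_trans sq1 k_gt.
have F0 : (0 < #|F|)%N.
  rewrite lt0n; apply/eqP => F0; move: t0.
  by rewrite -tF /min_degree big_pred0 ?F0 // => x; have := card0_eq F0 x; rewrite inE.
have /card_gt0P[x _] := F0.
have /card_gt0P[y] : (0 < degree x)%N.
  by apply: leq_trans (min_degree_le x); rewrite tF.
rewrite inE => xy.
have F1 : (1 < #|F|)%N.
  apply/card_gt1P; exists x, y; split => //; apply/eqP => xE.
  by move: xy; rewrite xE adj_irrefl.
have eta_k : 1 <= 6 / sq * k%:R by rewrite mulrAC ler_pdivlMr; lra.
have eta_t : 4 * k%:R / t.+1%:R <= 2 * (6 / sq).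
  rewrite ler_pdivrMr ?ltr0n // mulrA mulrAC ler_pdivlMr; last by lra.
  by rewrite -[t.+1%:R]natr1 -sq2; nra.
pose c : R := ((4 * #|F| + 1) * 2)%:R^-1.
have c0 : 0 < c by rewrite invr_gt0 ltr0n; lia.
have c1 : c <= 1 by rewrite invf_le1 ?ltr0n ?ler1n; lia.
exists (c / 2); first by apply/andP; split; lra.
move=> G G0 K4free.
have [I Iindep indep_le] := exists_max_independent G.
have codeg_le := codegree_le K4free indep_le.
have I0 : (0 < #|I|)%N.
  have /card_gt0P[z _] := G0; rewrite -(cards1 z); apply: indep_le => u v.
  by rewrite !inE => /eqP -> /eqP ->; rewrite adj_irrefl.
rewrite div1r; set B := _ `^ _.
(* A large independent set contains no copy of [F], as [F] has the edge [xy]; otherwise [a = #|I|]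
   is at most [B] and sampling applies. *)
have [BI|/ltW IB] := lerP B #|I|%:R.
  exists I; last first.
    by move=> f [_ f_hom fI]; move: (f_hom _ _ xy); apply/negP/Iindep.
  by apply: le_trans BI; rewrite ler_piMl ?powR_ge0 //; lra.
apply: (@sampled_set R F G #|I| k t c (6 / sq)) => //; first by rewrite tF.
by rewrite divr_ge0 //; lra.
Qed.

Local Open Scope classical_set_scope.
Local Open Scope ring_scope.

Theorem theorem1p4 (R : realType) (t : nat) (F : sgraph) :
  (0 < t)%N -> min_degree F = t ->
  (fun n : nat => (max_free F (complete_graph 4) n)%:R : R) \is
    'Omega_\oo (fun n : nat => n%:R `^ (1 / 2 - 6 / Num.sqrt t%:R) : R).
Proof.
move=> t0 tF; have [c /andP[c0 c1] sparse_set] := large_sparse_set R t0 tF.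
rewrite qualifE; apply/asboolP; exists c => //.
near=> n; set r := _ - _.
have n0 : (0 < n)%N by near: n; exists 1%N.
have n1 : 1 <= n%:R :> R by rewrite ler1n.
rewrite !ger0_norm ?powR_ge0 //.
have bound_n : c * n%:R `^ r <= n%:R.
  rewrite -[leRHS]mul1r; apply: ler_pM; rewrite ?powR_ge0 ?(ltW c0) //.
  rewrite -[leRHS]powRr1 // ler_powR // /r.
  have : 0 <= 6 / Num.sqrt t%:R :> R by rewrite divr_ge0 ?sqrtr_ge0.
  lra.
(* [max_free] asks for one [m] valid for all graphs on [n] vertices: the least integer not below
   [c n^r], which [bound_n] keeps within [n]. *)
have ex_m : exists m : nat, c * n%:R `^ r <= m%:R by exists n.
have [m mle m_min] := ex_minnP ex_m.
apply: le_trans mle _; rewrite ler_nat.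
have mn : (m < n.+1)%N by rewrite ltnS m_min.
apply: (@leq_bigmax_cond _ _ (fun m : 'I_n.+1 => m : nat) (Ordinal mn)).
apply/asboolP => G Gn K4free.
have [||S Sle Sfree] := sparse_set G; rewrite ?Gn //.
have mS : (m <= #|S|)%N by apply: m_min; rewrite -Gn.
(* [S] may exceed [m] vertices; any [m] of them still span no copy of [F]. *)
exists [set x in take m (enum S)]; split.
  rewrite cardsE (card_uniqP _) ?take_uniq ?enum_uniq // size_take_min -cardE.
  exact/minn_idPl.
apply: subgraph_free_induced => f [f_inj f_hom fS]; apply: (Sfree f); split => // x.
by have := fS x; rewrite inE => /mem_take; rewrite mem_enum.
Unshelve. all: by end_near. Qed.
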